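(* Let $\mathcal{C}$ be an additive symmetric monoidal category with finite coproducts and with reflexive coequalizers, the latter being preserved by the tensor product in each variable, and suppose that the forgetful functor $Alg\to\mathcal{C}$ from the category $Alg$ of commutative algebras in $\mathcal{C}$ has a left adjoint. Let $S$ be the induced monad (the symmetric algebra monad), so that $Alg\cong\mathcal{C}^S$, and regard $(\mathcal{C},S,d)$ as a codifferential category, where $d$ is the canonical deriving transform of $S$. Let $A\in\mathcal{C}^S$ and let $M$ be an $A$-module. Then a morphism $\partial:A\to M$ in $\mathcal{C}$ is an $S$-derivation if and only if $\partial$ is a derivation.
   Context: Composition is written in diagrammatic order: $f;g$ means first $f$, then $g$. Monoidal structures are written as if strict, with unit $k$ and symmetry $c$. An additive symmetric monoidal category is a symmetric monoidal category enriched over commutative monoids (hom-sets have addition and zero, composition is bilinear) whose tensor functor is additive in both variables. In such a category finite coproducts are biproducts, written $\oplus$, with projections $\pi_1,\pi_2$ and pairing $\langle f,g\rangle$. A commutative algebra is a commutative monoid object $(A,m_A,e_A)$; a module is a left module $\bullet_M:A\otimes M\to M$. A derivation $\partial:A\to M$ is a morphism with $m_A;\partial = c;(1\otimes\partial);\bullet_M+(1\otimes\partial);\bullet_M$ and $e_A;\partial=0$. For a commutative algebra $A$ and an $A$-module $M$, $A\oplus M$ is a commutative algebra with multiplication whose components are $(\pi_1\otimes\pi_1);m_A$ and $(\pi_1\otimes\pi_2);\bullet_M+c;(\pi_1\otimes\pi_2);\bullet_M$, and with unit $\langle e_A,0\rangle$; derivations $\partial:A\to M$ correspond to algebra homomorphisms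 $\langle 1_A,\partial\rangle:A\to A\oplus M$. Under the assumptions of the claim $Alg\to\mathcal{C}$ is monadic. With $(S,\eta,\mu)$ the induced monad, each $SC$ carries its free commutative algebra structure $(m,e)$, and $d_{SC}:SC\to SC\otimes C$ (where $SC\otimes C$ is the free $SC$-module on $C$, with action $m\otimes 1_C$) is the derivation for which $\langle 1_{SC},d_{SC}\rangle:SC\to SC\oplus(SC\otimes C)$ is the unique algebra homomorphism whose composite with $\eta_C$ is $\langle\eta_C,e\otimes 1_C\rangle:C\to SC\oplus(SC\otimes C)$. The data $(\mathcal{C},S,d)$ form a codifferential category: $S$ is a monad with natural commutative algebra structures on the objects $SC$ for which each $\mu_C$ is an algebra homomorphism, and $d$ is natural and satisfies (d1) $e;d=0$; (d2) $m;d=(1\otimes d);(m\otimes 1)+(d\otimes 1);c;(m\otimes 1)$; (d3) $\eta;d=e\otimes 1$; (d4) $\mu;d=d;(\mu\otimes d);(m\otimes 1)$. For an $S$-algebra $(A,\nu)$ and an $A$-module $M$, $W(A,M)$ is the $S$-algebra $(A\oplus M,\beta)$ with $\beta=\langle\beta_1,\beta_2\rangle:S(A\oplus M)\to A\oplus M$, $\beta_1=S\pi_1;\nu$ and $\beta_2=d_{S(A\oplus M)};(S\pi_1\otimes\pi_2);(\nu\otimes 1_M);\bullet_M$. An $S$-derivation is a morphism $\partial:A\to M$ in $\mathcal{C}$ such that $\langle 1_A,\partial\rangle:A\to A\oplus M$ is an $S$-algebra homomorphism $A\to W(A,M)$. *)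

(* Defs.v *)
(* Hom-sets are types compared with Leibniz equality.  Proof irrelevance is used
   only to compare algebra homomorphisms, which are morphisms packed with a
   proof. *)
From mathcomp Require Import ssreflect ssrfun.
From Stdlib Require Import ProofIrrelevance.

Set Implicit Arguments.
Unset Strict Implicit.
Unset Printing Implicit Defensive.

Declare Scope cat_scope.
Delimit Scope cat_scope with cat.
Local Open Scope cat_scope.

Reserved Notation "X ~> Y" (at level 70, no associativity).
Reserved Notation "f ;; g" (at level 45, right associativity).
Reserved Notation "X ⊗ Y" (at level 40, left associativity).
Reserved Notation "f ⊗₁ g" (at level 40, left associativity).

Record category := Category {
  ob :> Type;
  hom : ob -> ob -> Type;
  idm : forall X, hom X X;
  comp : forall X Y Z, hom X Y -> hom Y Z -> hom X Z;
  comp1m : forall X Y (f : hom X Y), comp (idm X) f = f;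
  compm1 : forall X Y (f : hom X Y), comp f (idm Y) = f;
  compA : forall X Y Z W (f : hom X Y) (g : hom Y Z) (h : hom Z W),
    comp f (comp g h) = comp (comp f g) h }.

Arguments hom {c} X Y.
Arguments idm {c} X.
Arguments comp {c X Y Z} f g.

Notation "X ~> Y" := (hom X Y) : type_scope.
(* Composition is in diagrammatic order: [f ;; g] is first [f], then [g]. *)
Notation "f ;; g" := (comp f g) : cat_scope.

Record functor (C D : category) := Functor {
  fobj :> C -> D;
  fmap : forall X Y : C, (X ~> Y) -> (fobj X ~> fobj Y);
  fmap1 : forall X : C, fmap (idm X) = idm (fobj X);
  fmapM : forall (X Y Z : C) (f : X ~> Y) (g : Y ~> Z),
    fmap (f ;; g) = fmap f ;; fmap g }.

Arguments fmap {C D} _ {X Y} _.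

Record left_adjoint (C D : category) (U : functor D C) := LeftAdjoint {
  ladj :> functor C D;
  aunit : forall X : C, X ~> U (ladj X);
  acounit : forall Y : D, ladj (U Y) ~> Y;
  aunit_nat : forall (X Y : C) (f : X ~> Y),
    f ;; aunit Y = aunit X ;; fmap U (fmap ladj f);
  acounit_nat : forall (X Y : D) (g : X ~> Y),
    fmap ladj (fmap U g) ;; acounit Y = acounit X ;; g;
  triangleF : forall X : C,
    fmap ladj (aunit X) ;; acounit (ladj X) = idm (ladj X);
  triangleU : forall Y : D,
    aunit (U Y) ;; fmap U (acounit Y) = idm (U Y) }.

Record monad (C : category) := Monad {
  mfun :> functor C C;
  eta : forall X : C, X ~> mfun X;
  mu : forall X : C, mfun (mfun X) ~> mfun X;
  eta_nat : forall (X Y : C) (f : X ~> Y), f ;; eta Y = eta X ;; fmap mfun f;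
  mu_nat : forall (X Y : C) (f : X ~> Y),
    fmap mfun (fmap mfun f) ;; mu Y = mu X ;; fmap mfun f;
  eta_mu : forall X : C, eta (mfun X) ;; mu X = idm (mfun X);
  fmap_eta_mu : forall X : C, fmap mfun (eta X) ;; mu X = idm (mfun X);
  mu_mu : forall X : C, fmap mfun (mu X) ;; mu X = mu (mfun X) ;; mu X }.

Record monad_alg (C : category) (T : monad C) := MonadAlg {
  mcar :> C;
  mact : T mcar ~> mcar;
  mact_unit : eta T mcar ;; mact = idm mcar;
  mact_mu : mu T mcar ;; mact = fmap T mact ;; mact }.

Definition is_monad_hom (C : category) (T : monad C) (A B : monad_alg T)
  (f : mcar A ~> mcar B) : Prop := fmap T f ;; mact B = mact A ;; f.

Lemma reassoc (C : category) (X Y Z W : C)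
  (f : X ~> Y) (g : Y ~> Z) (h : X ~> Z) (k : Z ~> W) :
  f ;; g = h -> f ;; (g ;; k) = h ;; k.
Proof. by move=> <-; rewrite compA. Qed.

Section CompositeFunctor.
Variables (C D E : category) (F : functor C D) (G : functor D E).

Lemma fcomp1 (X : C) : fmap G (fmap F (idm X)) = idm (G (F X)).
Proof. by rewrite !fmap1. Qed.

Lemma fcompM (X Y Z : C) (f : X ~> Y) (g : Y ~> Z) :
  fmap G (fmap F (f ;; g)) = fmap G (fmap F f) ;; fmap G (fmap F g).
Proof. by rewrite !fmapM. Qed.

Definition fcomp : functor C E :=
  @Functor C E (fun X => G (F X)) (fun X Y f => fmap G (fmap F f))
    fcomp1 fcompM.

End CompositeFunctor.

Section InducedMonad.
Variables (C D : category) (U : functor D C) (F : left_adjoint U).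

Let T := fcomp F U.
Let mult (X : C) : T (T X) ~> T X := fmap U (acounit F (F X)).

Lemma induced_mu_nat (X Y : C) (f : X ~> Y) :
  fmap T (fmap T f) ;; mult Y = mult X ;; fmap T f.
Proof. by rewrite /T /mult /= -!fmapM acounit_nat. Qed.

Lemma induced_eta_mu (X : C) : aunit F (T X) ;; mult X = idm (T X).
Proof. exact: (triangleU F (F X)). Qed.

Lemma induced_fmap_eta_mu (X : C) : fmap T (aunit F X) ;; mult X = idm (T X).
Proof. by rewrite /T /mult /= -!fmapM triangleF fmap1. Qed.

Lemma induced_mu_mu (X : C) : fmap T (mult X) ;; mult X = mult (T X) ;; mult X.
Proof. by rewrite /T /mult /= -!fmapM acounit_nat. Qed.

Definition induced_monad : monad C :=
  @Monad C T (aunit F) mult (@aunit_nat _ _ _ F) induced_mu_nat induced_eta_mu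
    induced_fmap_eta_mu induced_mu_mu.

Lemma comparison_unit (B : D) :
  eta induced_monad (U B) ;; fmap U (acounit F B) = idm (U B).
Proof. exact: triangleU. Qed.

Lemma comparison_mu (B : D) :
  mu induced_monad (U B) ;; fmap U (acounit F B) =
  fmap induced_monad (fmap U (acounit F B)) ;; fmap U (acounit F B).
Proof. by rewrite /= -!fmapM acounit_nat. Qed.

(* The comparison functor to the Eilenberg-Moore category, on objects. *)
Definition comparison (B : D) : monad_alg induced_monad :=
  @MonadAlg C induced_monad (U B) (fmap U (acounit F B)) (comparison_unit B)
    (comparison_mu B).

Lemma ladj_ext (X : C) (B : D) (f g : F X ~> B) :
  aunit F X ;; fmap U f = aunit F X ;; fmap U g -> f = g.
Proof.
have E (h : F X ~> B) : h = fmap F (aunit F X ;; fmap U h) ;; acounit F B.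
  by rewrite fmapM -compA acounit_nat compA triangleF comp1m.
by move=> e; rewrite (E f) (E g) e.
Qed.

Definition ladj_lift (X : C) (B : D) (f : X ~> U B) : F X ~> B :=
  fmap F f ;; acounit F B.

Lemma ladj_liftE (X : C) (B : D) (f : X ~> U B) :
  aunit F X ;; fmap U (ladj_lift f) = f.
Proof. by rewrite /ladj_lift fmapM compA -aunit_nat -compA triangleU compm1. Qed.

End InducedMonad.

Record finite_coproducts (C : category) := FiniteCoproducts {
  initial : C;
  from_initial : forall X : C, initial ~> X;
  initial_ext : forall (X : C) (f g : initial ~> X), f = g;
  coprod : C -> C -> C;
  inj1 : forall X Y : C, X ~> coprod X Y;
  inj2 : forall X Y : C, Y ~> coprod X Y;
  copair : forall X Y Z : C, (X ~> Z) -> (Y ~> Z) -> (coprod X Y ~> Z);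
  inj1_copair : forall (X Y Z : C) (f : X ~> Z) (g : Y ~> Z),
    inj1 X Y ;; copair f g = f;
  inj2_copair : forall (X Y Z : C) (f : X ~> Z) (g : Y ~> Z),
    inj2 X Y ;; copair f g = g;
  coprod_ext : forall (X Y Z : C) (f g : coprod X Y ~> Z),
    inj1 X Y ;; f = inj1 X Y ;; g -> inj2 X Y ;; f = inj2 X Y ;; g -> f = g }.

Definition is_coequalizer (C : category) (X Y Q : C) (f g : X ~> Y)
  (q : Y ~> Q) : Prop :=
  f ;; q = g ;; q /\
  forall (Z : C) (h : Y ~> Z), f ;; h = g ;; h ->
    exists! u : Q ~> Z, q ;; u = h.

Definition reflexive_pair (C : category) (X Y : C) (f g : X ~> Y) : Prop :=
  exists s : Y ~> X, s ;; f = idm Y /\ s ;; g = idm Y.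

Definition has_reflexive_coequalizers (C : category) : Prop :=
  forall (X Y : C) (f g : X ~> Y), reflexive_pair f g ->
    exists (Q : C) (q : Y ~> Q), is_coequalizer f g q.

Record sym_monoidal := SymMonoidal {
  smcat :> category;
  munit : smcat;
  tens : smcat -> smcat -> smcat;
  tensm : forall X Y Z W : smcat,
    (X ~> Y) -> (Z ~> W) -> (tens X Z ~> tens Y W);
  tensm1 : forall X Y : smcat, tensm (idm X) (idm Y) = idm (tens X Y);
  tensmM : forall (X Y Z X' Y' Z' : smcat)
      (f : X ~> Y) (g : Y ~> Z) (f' : X' ~> Y') (g' : Y' ~> Z'),
    tensm (f ;; g) (f' ;; g') = tensm f f' ;; tensm g g';
  assoc : forall X Y Z : smcat, tens (tens X Y) Z ~> tens X (tens Y Z);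
  associ : forall X Y Z : smcat, tens X (tens Y Z) ~> tens (tens X Y) Z;
  assocK : forall X Y Z, assoc X Y Z ;; associ X Y Z = idm _;
  associK : forall X Y Z, associ X Y Z ;; assoc X Y Z = idm _;
  assoc_nat : forall (X Y Z X' Y' Z' : smcat)
      (f : X ~> X') (g : Y ~> Y') (h : Z ~> Z'),
    tensm (tensm f g) h ;; assoc X' Y' Z' =
    assoc X Y Z ;; tensm f (tensm g h);
  lunit : forall X : smcat, tens munit X ~> X;
  luniti : forall X : smcat, X ~> tens munit X;
  lunitK : forall X, lunit X ;; luniti X = idm _;
  lunitiK : forall X, luniti X ;; lunit X = idm _;
  lunit_nat : forall (X Y : smcat) (f : X ~> Y),
    tensm (idm munit) f ;; lunit Y = lunit X ;; f;
  runit : forall X : smcat, tens X munit ~> X;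
  runiti : forall X : smcat, X ~> tens X munit;
  runitK : forall X, runit X ;; runiti X = idm _;
  runitiK : forall X, runiti X ;; runit X = idm _;
  runit_nat : forall (X Y : smcat) (f : X ~> Y),
    tensm f (idm munit) ;; runit Y = runit X ;; f;
  swap : forall X Y : smcat, tens X Y ~> tens Y X;
  swapK : forall X Y, swap X Y ;; swap Y X = idm _;
  swap_nat : forall (X Y X' Y' : smcat) (f : X ~> X') (g : Y ~> Y'),
    tensm f g ;; swap X' Y' = swap X Y ;; tensm g f;
  pentagon : forall X Y Z W : smcat,
    tensm (assoc X Y Z) (idm W) ;; assoc X (tens Y Z) W
      ;; tensm (idm X) (assoc Y Z W) =
    assoc (tens X Y) Z W ;; assoc X Y (tens Z W);
  triangle : forall X Y : smcat,
    assoc X munit Y ;; tensm (idm X) (lunit Y) = tensm (runit X) (idm Y);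
  hexagon : forall X Y Z : smcat,
    assoc X Y Z ;; swap X (tens Y Z) ;; assoc Y Z X =
    tensm (swap X Y) (idm Z) ;; assoc Y X Z ;; tensm (idm Y) (swap X Z);
  swap_lunit : forall X : smcat, swap X munit ;; lunit X = runit X }.

Arguments munit {s}.
Arguments tens {s} X Y.
Arguments tensm {s X Y Z W} f g.
Arguments assoc {s} X Y Z.
Arguments associ {s} X Y Z.
Arguments lunit {s} X.
Arguments luniti {s} X.
Arguments runit {s} X.
Arguments runiti {s} X.
Arguments swap {s} X Y.

Notation "X ⊗ Y" := (tens X Y) : cat_scope.
Notation "f ⊗₁ g" := (tensm f g) : cat_scope.

Definition tensor_preserves_reflexive_coequalizers (C : sym_monoidal) : Prop :=
  forall (X Y Q : C) (f g : X ~> Y) (q : Y ~> Q),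
    reflexive_pair f g -> is_coequalizer f g q ->
    forall Z : C,
      is_coequalizer (f ⊗₁ idm Z) (g ⊗₁ idm Z) (q ⊗₁ idm Z) /\
      is_coequalizer (idm Z ⊗₁ f) (idm Z ⊗₁ g) (idm Z ⊗₁ q).

Record add_sym_monoidal := AddSymMonoidal {
  asmcat :> sym_monoidal;
  zerom : forall X Y : asmcat, X ~> Y;
  addm : forall X Y : asmcat, (X ~> Y) -> (X ~> Y) -> (X ~> Y);
  addmA : forall (X Y : asmcat) (f g h : X ~> Y),
    addm f (addm g h) = addm (addm f g) h;
  addmC : forall (X Y : asmcat) (f g : X ~> Y), addm f g = addm g f;
  add0m : forall (X Y : asmcat) (f : X ~> Y), addm (zerom X Y) f = f;
  comp0m : forall (X Y Z : asmcat) (f : Y ~> Z),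
    zerom X Y ;; f = zerom X Z;
  compm0 : forall (X Y Z : asmcat) (f : X ~> Y),
    f ;; zerom Y Z = zerom X Z;
  compDl : forall (X Y Z : asmcat) (f g : X ~> Y) (h : Y ~> Z),
    addm f g ;; h = addm (f ;; h) (g ;; h);
  compDr : forall (X Y Z : asmcat) (f : X ~> Y) (g h : Y ~> Z),
    f ;; addm g h = addm (f ;; g) (f ;; h);
  tens0m : forall (X Y Z W : asmcat) (g : Z ~> W),
    zerom X Y ⊗₁ g = zerom (X ⊗ Z) (Y ⊗ W);
  tensm0 : forall (X Y Z W : asmcat) (f : X ~> Y),
    f ⊗₁ zerom Z W = zerom (X ⊗ Z) (Y ⊗ W);
  tensDl : forall (X Y Z W : asmcat) (f g : X ~> Y) (h : Z ~> W),
    addm f g ⊗₁ h = addm (f ⊗₁ h) (g ⊗₁ h);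
  tensDr : forall (X Y Z W : asmcat) (f : X ~> Y) (g h : Z ~> W),
    f ⊗₁ addm g h = addm (f ⊗₁ g) (f ⊗₁ h) }.

Arguments zerom {a} X Y.
Arguments addm {a X Y} f g.

Notation "0" := (zerom _ _) : cat_scope.
Notation "f + g" := (addm f g) : cat_scope.

Lemma addm0 (C : add_sym_monoidal) (X Y : C) (f : X ~> Y) : f + 0 = f.
Proof. by rewrite addmC add0m. Qed.

(* Finite coproducts are biproducts here, so the projections and the pairing
   are derived rather than assumed. *)
Section Biproducts.
Variables (C : add_sym_monoidal) (P : finite_coproducts C).
Implicit Types X Y Z : C.

Definition pi1 X Y : coprod P X Y ~> X := copair P (idm X) 0.
Definition pi2 X Y : coprod P X Y ~> Y := copair P 0 (idm Y).
Definition pair X Y Z (f : Z ~> X) (g : Z ~> Y) : Z ~> coprod P X Y :=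
  f ;; inj1 P X Y + g ;; inj2 P X Y.

Lemma pair_pi1 X Y Z (f : Z ~> X) (g : Z ~> Y) : pair f g ;; pi1 X Y = f.
Proof.
by rewrite compDl -!compA inj1_copair inj2_copair compm1 compm0 addm0.
Qed.

Lemma pair_pi2 X Y Z (f : Z ~> X) (g : Z ~> Y) : pair f g ;; pi2 X Y = g.
Proof.
by rewrite compDl -!compA inj1_copair inj2_copair compm1 compm0 add0m.
Qed.

Lemma pair_pi X Y : pair (pi1 X Y) (pi2 X Y) = idm (coprod P X Y).
Proof.
apply: (@coprod_ext _ P); rewrite compDr !compA ?inj1_copair ?inj2_copair.
  by rewrite comp0m comp1m compm1 addm0.
by rewrite comp0m comp1m compm1 add0m.
Qed.

Lemma comp_pair X Y Z W (h : W ~> Z) (f : Z ~> X) (g : Z ~> Y) :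
  h ;; pair f g = pair (h ;; f) (h ;; g).
Proof. by rewrite /pair compDr !compA. Qed.

Lemma pair_ext X Y Z (f g : Z ~> coprod P X Y) :
  f ;; pi1 X Y = g ;; pi1 X Y -> f ;; pi2 X Y = g ;; pi2 X Y -> f = g.
Proof.
move=> e1 e2; rewrite -(compm1 f) -(compm1 g) -pair_pi.
by rewrite !comp_pair e1 e2.
Qed.

End Biproducts.

Arguments pi1 {C} P X Y.
Arguments pi2 {C} P X Y.
Arguments pair {C} P {X Y Z} f g.

Record comm_alg_on (C : sym_monoidal) (A : C) := CommAlgOn {
  mul : A ⊗ A ~> A;
  one : munit ~> A;
  mul_assoc : (mul ⊗₁ idm A) ;; mul = assoc A A A ;; (idm A ⊗₁ mul) ;; mul;
  one_mul : (one ⊗₁ idm A) ;; mul = lunit A;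
  mul_one : (idm A ⊗₁ one) ;; mul = runit A;
  mul_comm : swap A A ;; mul = mul }.

Record comm_alg (C : sym_monoidal) := CommAlg {
  acar :> C;
  astr :> comm_alg_on acar }.

Definition is_alg_hom (C : sym_monoidal) (A B : comm_alg C)
  (f : acar A ~> acar B) : Prop :=
  mul A ;; f = (f ⊗₁ f) ;; mul B /\ one A ;; f = one B.

Record alg_hom (C : sym_monoidal) (A B : comm_alg C) := AlgHom {
  ahom :> acar A ~> acar B;
  ahomP : is_alg_hom ahom }.

Record module (C : sym_monoidal) (A : comm_alg C) := Module {
  modcar :> C;
  act : A ⊗ modcar ~> modcar;
  mul_act : (mul A ⊗₁ idm modcar) ;; act =
    assoc A A modcar ;; (idm (acar A) ⊗₁ act) ;; act;
  one_act : (one A ⊗₁ idm modcar) ;; act = lunit modcar }.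

Definition is_derivation (C : add_sym_monoidal) (A : comm_alg C)
  (M : module A) (D : acar A ~> modcar M) : Prop :=
  mul A ;; D = swap A A ;; (idm (acar A) ⊗₁ D) ;; act M
               + (idm (acar A) ⊗₁ D) ;; act M /\
  one A ;; D = 0.

Section MonoidalLemmas.
Variable C : sym_monoidal.
Implicit Types X Y Z W : C.

Lemma tens_split X Y Z W (f : X ~> Y) (g : Z ~> W) :
  f ⊗₁ g = (f ⊗₁ idm Z) ;; (idm Y ⊗₁ g).
Proof. by rewrite -tensmM comp1m compm1. Qed.

Lemma tens_split' X Y Z W (f : X ~> Y) (g : Z ~> W) :
  f ⊗₁ g = (idm X ⊗₁ g) ;; (f ⊗₁ idm W).
Proof. by rewrite -tensmM comp1m compm1. Qed.

Lemma tens1M X Y Z W (f : X ~> Y) (g : Y ~> Z) :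
  idm W ⊗₁ (f ;; g) = (idm W ⊗₁ f) ;; (idm W ⊗₁ g).
Proof. by rewrite -tensmM comp1m. Qed.

Lemma tensM1 X Y Z W (f : X ~> Y) (g : Y ~> Z) :
  (f ;; g) ⊗₁ idm W = (f ⊗₁ idm W) ;; (g ⊗₁ idm W).
Proof. by rewrite -tensmM comp1m. Qed.

Lemma tensMl X Y Z U V (f : X ~> Y) (g : Y ~> Z) (h : U ~> V) :
  (f ;; g) ⊗₁ h = (f ⊗₁ h) ;; (g ⊗₁ idm V).
Proof. by rewrite -tensmM compm1. Qed.

Lemma tensMr X Y Z U V (f : X ~> Y) (g : Y ~> Z) (h : U ~> V) :
  h ⊗₁ (f ;; g) = (h ⊗₁ f) ;; (idm V ⊗₁ g).
Proof. by rewrite -tensmM compm1. Qed.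

Lemma tensMr' X Y Z U V (f : X ~> Y) (g : Y ~> Z) (h : U ~> V) :
  h ⊗₁ (f ;; g) = (idm U ⊗₁ f) ;; (h ⊗₁ g).
Proof. by rewrite -tensmM comp1m. Qed.

Lemma associ_nat X Y Z X' Y' Z' (f : X ~> X') (g : Y ~> Y') (h : Z ~> Z') :
  (f ⊗₁ (g ⊗₁ h)) ;; associ X' Y' Z' = associ X Y Z ;; ((f ⊗₁ g) ⊗₁ h).
Proof.
rewrite -[LHS]comp1m -associK -!compA; congr (_ ;; _).
by rewrite !compA -assoc_nat -compA assocK compm1.
Qed.

Lemma luniti_nat X Y (f : X ~> Y) :
  f ;; luniti Y = luniti X ;; (idm munit ⊗₁ f).
Proof.
by rewrite -[RHS]compm1 -lunitK !compA -(compA _ _ (lunit Y)) lunit_nat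
  compA lunitiK comp1m.
Qed.

Lemma lunit_tens_inj X Y (f g : X ~> Y) :
  idm munit ⊗₁ f = idm munit ⊗₁ g -> f = g.
Proof.
move=> e; rewrite -(comp1m f) -(comp1m g) -lunitiK -!compA.
by rewrite -!lunit_nat e.
Qed.

Lemma assoc_lunit X Y :
  assoc munit X Y ;; lunit (X ⊗ Y) = lunit X ⊗₁ idm Y.
Proof.
apply: lunit_tens_inj.
have inj (f g : munit ⊗ ((munit ⊗ X) ⊗ Y) ~> munit ⊗ (X ⊗ Y)) :
  ((assoc munit munit X ⊗₁ idm Y) ;; assoc munit (munit ⊗ X) Y) ;; f =
  ((assoc munit munit X ⊗₁ idm Y) ;; assoc munit (munit ⊗ X) Y) ;; g -> f = g.
  move=> e.
  have K : (associ munit (munit ⊗ X) Y ;; (associ munit munit X ⊗₁ idm Y)) ;;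
           ((assoc munit munit X ⊗₁ idm Y) ;; assoc munit (munit ⊗ X) Y)
           = idm _.
    rewrite -compA (compA (_ ⊗₁ _)) -tensmM associK comp1m tensm1 comp1m.
    exact: associK.
  by rewrite -(comp1m f) -(comp1m g) -K -!(compA (_ ;; _)) e.
apply: inj; rewrite tens1M -!compA (compA (assoc _ _ _) (_ ⊗₁ _)).
rewrite (compA (_ ⊗₁ _)) pentagon -!compA triangle -(tensm1 X Y) -!assoc_nat.
by rewrite compA -triangle -tensM1.
Qed.

Lemma associ_lunit X Y :
  associ munit X Y ;; (lunit X ⊗₁ idm Y) = lunit (X ⊗ Y).
Proof. by rewrite -assoc_lunit compA associK comp1m. Qed.

Lemma hexagon' X Y Z :
  swap (X ⊗ Y) Z ;; associ Z X Y =
  assoc X Y Z ;; (idm X ⊗₁ swap Y Z) ;; associ X Z Y ;; (swap X Z ⊗₁ idm Y).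
Proof.
have K : (assoc Z X Y ;; swap Z (X ⊗ Y) ;; assoc X Y Z) ;;
         (associ X Y Z ;; swap (X ⊗ Y) Z ;; associ Z X Y) = idm _.
  rewrite -!compA (compA (assoc X Y Z)) assocK comp1m (compA (swap _ _)).
  by rewrite swapK comp1m assocK.
have K' : ((idm X ⊗₁ swap Y Z) ;; associ X Z Y ;; (swap X Z ⊗₁ idm Y)) ;;
          (assoc Z X Y ;; swap Z (X ⊗ Y) ;; assoc X Y Z) = idm _.
  rewrite hexagon -!compA (compA (_ ⊗₁ idm Y)) -tensmM swapK comp1m tensm1.
  by rewrite comp1m (compA (associ _ _ _)) associK comp1m -tensmM swapK comp1m
    tensm1.
rewrite -[LHS]comp1m -(assocK X Y Z) -!compA; congr (_ ;; _).
rewrite -!compA in K; by rewrite -[LHS]comp1m -K' -!compA K compm1.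
Qed.

End MonoidalLemmas.

Lemma act_act (C : sym_monoidal) (A : comm_alg C) (M : module A) (X Y Z : C)
  (f : X ~> A) (g : Y ~> A) (h : Z ~> modcar M) :
  f ⊗₁ ((g ⊗₁ h) ;; act M) ;; act M =
  associ X Y Z ;; (((f ⊗₁ g) ;; mul A) ⊗₁ h) ;; act M.
Proof.
have e : (idm _ ⊗₁ act M) ;; act M = associ A A _ ;; (mul A ⊗₁ idm _) ;; act M.
  by rewrite mul_act compA associK comp1m.
by rewrite tensMr tensMl -!compA e compA associ_nat -compA.
Qed.

Lemma swap_mul (C : sym_monoidal) (A : comm_alg C) (X Y : C)
  (f : X ~> A) (g : Y ~> A) :
  swap Y X ;; (f ⊗₁ g) ;; mul A = (g ⊗₁ f) ;; mul A.
Proof. by rewrite compA -swap_nat -compA mul_comm. Qed.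

Section FreeModule.
Variables (C : sym_monoidal) (A : comm_alg C) (X : C).

Definition free_act : A ⊗ (A ⊗ X) ~> A ⊗ X :=
  associ A A X ;; (mul A ⊗₁ idm X).

Lemma free_mul_act :
  (mul A ⊗₁ idm (A ⊗ X)) ;; free_act =
  assoc A A (A ⊗ X) ;; (idm (acar A) ⊗₁ free_act) ;; free_act.
Proof.
rewrite /free_act -(tensm1 A X) (compA _ (associ _ _ _)) associ_nat tens1M.
rewrite -!compA (compA (_ ⊗₁ (_ ⊗₁ _)) (associ _ _ _)) associ_nat -!compA.
rewrite -!tensM1 mul_assoc !tensM1.
rewrite -[RHS]comp1m -(associK (A ⊗ A) A X) -!compA; congr (_ ;; _).
rewrite (compA (assoc _ _ _) (assoc _ _ _)) -pentagon -!compA.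
rewrite (compA (idm _ ⊗₁ assoc _ _ _)) -tens1M assocK tensm1 comp1m.
by rewrite (compA (assoc _ (_ ⊗ _) _)) assocK comp1m.
Qed.

Lemma free_one_act : (one A ⊗₁ idm (A ⊗ X)) ;; free_act = lunit (A ⊗ X).
Proof.
rewrite /free_act -(tensm1 A X) compA associ_nat -compA -tensM1 one_mul.
exact: associ_lunit.
Qed.

Definition free_module : module A := Module free_mul_act free_one_act.

End FreeModule.

Section SquareZero.
Variables (C : add_sym_monoidal) (P : finite_coproducts C).
Variables (A : comm_alg C) (M : module A).

Let E : C := coprod P A M.
Let p1 : E ~> A := pi1 P A M.
Let p2 : E ~> M := pi2 P A M.

Definition sqz_mul : E ⊗ E ~> E :=
  pair P ((p1 ⊗₁ p1) ;; mul A)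
    ((p1 ⊗₁ p2) ;; act M + swap E E ;; (p1 ⊗₁ p2) ;; act M).

Definition sqz_one : munit ~> E := pair P (one A) 0.

Lemma sqz_mul1 : sqz_mul ;; p1 = (p1 ⊗₁ p1) ;; mul A.
Proof. exact: pair_pi1. Qed.

Lemma sqz_mul2 : sqz_mul ;; p2 =
  (p1 ⊗₁ p2) ;; act M + swap E E ;; (p1 ⊗₁ p2) ;; act M.
Proof. exact: pair_pi2. Qed.

Lemma sqz_one1 : sqz_one ;; p1 = one A.
Proof. exact: pair_pi1. Qed.

Lemma sqz_one2 : sqz_one ;; p2 = 0.
Proof. exact: pair_pi2. Qed.

Lemma sqz_comm : swap E E ;; sqz_mul = sqz_mul.
Proof.
apply: pair_ext; rewrite -/p1 -/p2 -compA.
  by rewrite sqz_mul1 compA -swap_nat -compA mul_comm.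
by rewrite sqz_mul2 compDr (compA _ (swap E E)) swapK comp1m addmC.
Qed.

Lemma sqz_one_mul : (sqz_one ⊗₁ idm E) ;; sqz_mul = lunit E.
Proof.
apply: pair_ext; rewrite -/p1 -/p2 -compA.
  rewrite sqz_mul1 compA -tensmM comp1m sqz_one1 tens_split' -compA one_mul.
  exact: lunit_nat.
rewrite sqz_mul2 compDr !(compA (sqz_one ⊗₁ idm E)) swap_nat -!compA.
rewrite !(compA (_ ⊗₁ _) (_ ⊗₁ _)) -!tensmM !comp1m sqz_one1 sqz_one2.
by rewrite tensm0 comp0m compm0 addm0 tens_split' -compA one_act lunit_nat.
Qed.

Lemma sqz_mul_one : (idm E ⊗₁ sqz_one) ;; sqz_mul = runit E.
Proof.
by rewrite -sqz_comm compA swap_nat -compA sqz_one_mul swap_lunit.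
Qed.

Lemma sqz_assoc :
  (sqz_mul ⊗₁ idm E) ;; sqz_mul =
  assoc E E E ;; (idm E ⊗₁ sqz_mul) ;; sqz_mul.
Proof.
apply: pair_ext; rewrite -/p1 -/p2 -!compA.
  rewrite sqz_mul1 !(compA (_ ⊗₁ _) (_ ⊗₁ _)) -!tensmM sqz_mul1 !comp1m.
  rewrite tensMl tensMr -!compA mul_assoc.
  by rewrite (compA (_ ⊗₁ _) (assoc _ _ _)) assoc_nat -!compA.
rewrite sqz_mul2 !compDr.
rewrite !(compA (sqz_mul ⊗₁ idm E)) !(compA (idm E ⊗₁ sqz_mul)) !swap_nat.
rewrite -!compA !(compA (_ ⊗₁ _) (_ ⊗₁ _)) -!tensmM !comp1m !sqz_mul1 !sqz_mul2.
rewrite !tensDr !compDl !compDr -!addmA; congr (_ + _); last congr (_ + _).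
- rewrite tensMl tensMr -!compA mul_act.
  by rewrite (compA (_ ⊗₁ _) (assoc _ _ _)) assoc_nat -!compA.
- rewrite (tensMr' (swap E E)) -!compA !act_act (compA _ (associ _ _ _)).
  by rewrite hexagon' -!compA (compA (swap E E ⊗₁ _)) -tensmM comp1m swap_mul.
- have H : swap (E ⊗ E) E ;; idm E ⊗₁ swap E E =
           swap E E ⊗₁ idm E ;; swap (E ⊗ E) E by rewrite swap_nat.
  rewrite (tensMr' (swap E E)) -!compA (compA _ (_ ⊗₁ _)) H act_act -compA.
  rewrite (compA (swap (E ⊗ E) E)) hexagon' -!compA.
  rewrite (compA (_ ⊗₁ _) (_ ⊗₁ p2)) -tensmM comp1m swap_mul !compA.
  rewrite -(compA (swap E E ⊗₁ _) (assoc _ _ _)) -hexagon -!compA.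
  by rewrite (compA (assoc _ _ _) (associ _ _ _)) assocK comp1m.
Qed.

Definition sqz_on : comm_alg_on E :=
  CommAlgOn sqz_assoc sqz_one_mul sqz_mul_one sqz_comm.

Definition sqz : comm_alg C := CommAlg sqz_on.

Lemma pair_alg_hom (B : comm_alg C) (f : B ~> A) (D : B ~> modcar M) :
  is_alg_hom (B := sqz) (pair P f D) <->
  is_alg_hom f /\
  mul B ;; D = (f ⊗₁ D) ;; act M + swap B B ;; (f ⊗₁ D) ;; act M /\
  one B ;; D = 0.
Proof.
have e1 : pair P f D ;; p1 = f by exact: pair_pi1.
have e2 : pair P f D ;; p2 = D by exact: pair_pi2.
have m1 : (pair P f D ⊗₁ pair P f D) ;; sqz_mul ;; p1 = (f ⊗₁ f) ;; mul A.
  by rewrite sqz_mul1 compA -tensmM e1.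
have m2 : (pair P f D ⊗₁ pair P f D) ;; sqz_mul ;; p2 =
    (f ⊗₁ D) ;; act M + swap B B ;; (f ⊗₁ D) ;; act M.
  rewrite sqz_mul2 compDr (compA _ (swap E E)) swap_nat -compA.
  by rewrite !(compA (_ ⊗₁ _)) -!tensmM e1 e2.
split=> [[/= hm ho]|[[hm ho] [hmD hoD]]].
  move: (f_equal (comp^~ p1) hm) (f_equal (comp^~ p2) hm).
  move: (f_equal (comp^~ p1) ho) (f_equal (comp^~ p2) ho).
  by rewrite /= -!compA e1 e2 m1 m2 sqz_one1 sqz_one2.
split=> /=; apply: pair_ext; rewrite -/p1 -/p2 -!compA ?m1 ?m2
  ?sqz_one1 ?sqz_one2;
  by rewrite ?e1 ?e2.
Qed.

End SquareZero.

Lemma derivationP (C : add_sym_monoidal) (P : finite_coproducts C)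
  (A : comm_alg C) (M : module A) (D : A ~> modcar M) :
  is_derivation D <-> is_alg_hom (B := sqz P M) (pair P (idm (acar A)) D).
Proof.
split=> [[h h1]|/pair_alg_hom [_ [h h1]]]; last by split; rewrite // addmC.
apply/pair_alg_hom; rewrite addmC; do !split=> //.
  by rewrite compm1 tensm1 comp1m.
exact: compm1.
Qed.

Record codifferential (C : add_sym_monoidal) := Codifferential {
  cdmonad :> monad C;
  cdalg : forall X : C, comm_alg_on (cdmonad X);
  (* i.e. the multiplications and the units are natural in [X] *)
  cdalg_nat : forall (X Y : C) (f : X ~> Y),
    is_alg_hom (A := CommAlg (cdalg X)) (B := CommAlg (cdalg Y))
      (fmap cdmonad f);
  cdmu_hom : forall X : C,
    is_alg_hom (A := CommAlg (cdalg (cdmonad X))) (B := CommAlg (cdalg X))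
      (mu cdmonad X);
  deriv : forall X : C, cdmonad X ~> cdmonad X ⊗ X;
  deriv_nat : forall (X Y : C) (f : X ~> Y),
    fmap cdmonad f ;; deriv Y = deriv X ;; (fmap cdmonad f ⊗₁ f);
  deriv_one : forall X : C, one (cdalg X) ;; deriv X = 0;
  deriv_mul : forall X : C,
    mul (cdalg X) ;; deriv X =
    (idm _ ⊗₁ deriv X) ;; associ _ _ _ ;; (mul (cdalg X) ⊗₁ idm X)
    + (deriv X ⊗₁ idm _) ;; swap _ _ ;; associ _ _ _
        ;; (mul (cdalg X) ⊗₁ idm X);
  deriv_eta : forall X : C,
    eta cdmonad X ;; deriv X = luniti X ;; (one (cdalg X) ⊗₁ idm X);
  deriv_mu : forall X : C,
    mu cdmonad X ;; deriv X =
    deriv (cdmonad X) ;; (mu cdmonad X ⊗₁ deriv X) ;; associ _ _ _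
      ;; (mul (cdalg X) ⊗₁ idm X) }.

Definition cdfree (C : add_sym_monoidal) (S : codifferential C) (X : C) :
  comm_alg C := CommAlg (cdalg S X).

Section MonadAlgebraAsCommAlgebra.
Variables (C : add_sym_monoidal) (S : codifferential C) (A : monad_alg S).

Let nu := mact A.
Let h : mcar A ~> S (mcar A) := eta S (mcar A).

(* An [S]-algebra [A] is a commutative algebra by transport along its structure
   map, which is split by [eta].  For the symmetric algebra monad this is the
   inverse of the comparison: see [comparison_malg] and [malg_comparison]. *)
Definition malg_mul : mcar A ⊗ mcar A ~> mcar A :=
  (h ⊗₁ h) ;; mul (cdfree S (mcar A)) ;; nu.
Definition malg_one : munit ~> mcar A := one (cdfree S (mcar A)) ;; nu.

Lemma mact_mul : mul (cdfree S (mcar A)) ;; nu = (nu ⊗₁ nu) ;; malg_mul.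
Proof.
rewrite /malg_mul compA -tensmM /nu /h eta_nat tensmM -compA.
have [e _] := cdalg_nat S (mact A).
rewrite (compA (fmap S _ ⊗₁ _)) -e -compA -mact_mu (compA (mul _)).
have [e' _] := cdmu_hom S (mcar A).
by rewrite /= e' -compA compA -tensmM eta_mu tensm1 comp1m.
Qed.

Lemma h_nu : h ;; nu = idm (mcar A).
Proof. exact: mact_unit. Qed.

Lemma malg_assoc : (malg_mul ⊗₁ idm (mcar A)) ;; malg_mul =
  assoc _ _ _ ;; (idm (mcar A) ⊗₁ malg_mul) ;; malg_mul.
Proof.
have L : malg_mul ⊗₁ idm (mcar A) =
    (((h ⊗₁ h) ;; mul (cdfree S (mcar A))) ⊗₁ h) ;; (nu ⊗₁ nu).
  by rewrite -tensmM h_nu -compA.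
have R : idm (mcar A) ⊗₁ malg_mul =
    (h ⊗₁ ((h ⊗₁ h) ;; mul (cdfree S (mcar A)))) ;; (nu ⊗₁ nu).
  by rewrite -tensmM h_nu -compA.
rewrite {}L {}R -!compA -mact_mul tensMl tensMr -!compA.
rewrite (compA _ (mul _) nu) mul_assoc -!compA.
by rewrite (compA (_ ⊗₁ _) (assoc _ _ _)) assoc_nat -!compA.
Qed.

Lemma malg_comm : swap _ _ ;; malg_mul = malg_mul.
Proof. by rewrite /malg_mul !compA -(compA (swap _ _)) swap_mul. Qed.

Lemma malg_one_mul : (malg_one ⊗₁ idm (mcar A)) ;; malg_mul = lunit (mcar A).
Proof.
rewrite -h_nu /malg_one tensmM -compA -mact_mul (compA _ _ nu) tens_split'.
by rewrite -(compA _ _ (mul _)) one_mul lunit_nat -compA h_nu compm1.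
Qed.

Lemma malg_mul_one : (idm (mcar A) ⊗₁ malg_one) ;; malg_mul = runit (mcar A).
Proof.
by rewrite -malg_comm compA swap_nat -compA malg_one_mul swap_lunit.
Qed.

Definition malg : comm_alg C :=
  CommAlg (CommAlgOn malg_assoc malg_one_mul malg_mul_one malg_comm).

Lemma mact_hom : is_alg_hom (A := cdfree S (mcar A)) (B := malg) nu.
Proof. by split; first exact: mact_mul. Qed.

End MonadAlgebraAsCommAlgebra.

Lemma act_unit (C : sym_monoidal) (A B : comm_alg C) (M : module A) (X : C)
    (f : B ~> A) (h : X ~> modcar M) :
  one B ;; f = one A ->
  (luniti X ;; (one B ⊗₁ idm X)) ;; (f ⊗₁ h) ;; act M = h.
Proof.
move=> e; rewrite -compA (compA (_ ⊗₁ _)) -tensmM comp1m e tens_split' -compA.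
by rewrite one_act lunit_nat compA lunitiK comp1m.
Qed.

Section ModuleExtension.
Variables (C : add_sym_monoidal) (P : finite_coproducts C).
Variables (S : codifferential C) (A : monad_alg S) (M : module (malg A)).

Let E : C := coprod P (mcar A) (modcar M).
Let p1 : E ~> mcar A := pi1 P (mcar A) (modcar M).
Let p2 : E ~> modcar M := pi2 P (mcar A) (modcar M).

Definition wact1 : S E ~> mcar A := fmap S p1 ;; mact A.
Definition wact2 : S E ~> modcar M :=
  deriv S E ;; (fmap S p1 ⊗₁ p2) ;; (mact A ⊗₁ idm (modcar M)) ;; act M.
Definition wact : S E ~> E := pair P wact1 wact2.

Lemma wact1_hom : is_alg_hom (A := cdfree S E) (B := malg A) wact1.
Proof.
have [e e'] := cdalg_nat S p1; have [u u'] := mact_hom A.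
by split; rewrite /wact1 compA ?e ?e' // -compA u compA -tensmM.
Qed.

Lemma wact2E : wact2 = deriv S E ;; (wact1 ⊗₁ p2) ;; act M.
Proof. by rewrite /wact2 (compA (_ ⊗₁ _)) -tensmM compm1. Qed.

Lemma wact_unit : eta S E ;; wact = idm E.
Proof.
rewrite /wact comp_pair -pair_pi; congr (pair P _ _).
  by rewrite /wact1 compA -eta_nat -compA mact_unit compm1.
rewrite wact2E compA deriv_eta.
exact: (act_unit p2 wact1_hom.2).
Qed.

Lemma wact1_mu : mu S E ;; wact1 = fmap S wact ;; wact1.
Proof.
rewrite {2}/wact1 (compA (fmap S wact)) -fmapM /wact pair_pi1.
by rewrite /wact1 compA -mu_nat -compA mact_mu fmapM compA.
Qed.

Lemma wact_mu : mu S E ;; wact = fmap S wact ;; wact.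
Proof.
rewrite {1 3}/wact !comp_pair wact1_mu; congr (pair P _ _).
rewrite !wact2E compA deriv_mu (compA (fmap S wact)) deriv_nat -!compA.
have [e _] := wact1_hom; rewrite (compA (mul _ ⊗₁ _)) -tensmM comp1m.
rewrite [mul _ ;; _]e.
rewrite -(act_act (M := M)) !(compA (_ ⊗₁ _)) -!tensmM wact1_mu.
by rewrite -/p2 /wact pair_pi2 wact2E.
Qed.

Definition W : monad_alg S := MonadAlg wact_unit wact_mu.

Definition is_S_derivation (D : mcar A ~> modcar M) : Prop :=
  is_monad_hom (A := A) (B := W) (pair P (idm (mcar A)) D).

End ModuleExtension.

Section CategoryOfAlgebras.
Variable C : sym_monoidal.

Lemma alg_hom_ext (A B : comm_alg C) (f g : alg_hom A B) :
  ahom f = ahom g -> f = g.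
Proof.
case: f g => f hf [g hg] /= e; case: g / e hg => hg.
by rewrite (proof_irrelevance _ hf hg).
Qed.

Lemma idm_alg_hom (A : comm_alg C) : is_alg_hom (A := A) (B := A) (idm A).
Proof. by split; rewrite ?compm1 // tensm1 comp1m. Qed.

Lemma comp_alg_hom (A B D : comm_alg C) (f : A ~> B) (g : B ~> D) :
  is_alg_hom f -> is_alg_hom g -> is_alg_hom (A := A) (B := D) (f ;; g).
Proof.
move=> [fm f1] [gm g1]; split; last by rewrite compA f1.
by rewrite compA fm -compA gm compA -tensmM.
Qed.

Definition alg_cat : category.
Proof.
refine (@Category (comm_alg C) (@alg_hom C) (fun A => AlgHom (idm_alg_hom A))
  (fun A B D f g => AlgHom (comp_alg_hom (ahomP f) (ahomP g))) _ _ _).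
- by move=> A B f; apply: alg_hom_ext; apply: comp1m.
- by move=> A B f; apply: alg_hom_ext; apply: compm1.
- by move=> A B D E f g h; apply: alg_hom_ext; apply: compA.
Defined.

Definition forget : functor alg_cat C :=
  @Functor alg_cat C (@acar C) (fun A B f => ahom f)
    (fun A => erefl) (fun A B D f g => erefl).

End CategoryOfAlgebras.

Section SymmetricAlgebra.
Variables (C : add_sym_monoidal) (P : finite_coproducts C).
Variable F : left_adjoint (forget C).

Let S : monad C := induced_monad F.
Let FX (X : C) : comm_alg C := F X.

Lemma sym_hom_ext (X : C) (B : comm_alg C) (f g : S X ~> B) :
  is_alg_hom (A := FX X) f -> is_alg_hom (A := FX X) g ->
  eta S X ;; f = eta S X ;; g -> f = g.
Proof.
move=> hf hg e.
exact: (f_equal (@ahom C _ _)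
  (@ladj_ext _ _ _ F X B (AlgHom hf) (AlgHom hg) e)).
Qed.

(* The unique algebra homomorphism extending [⟨eta, e ⊗ 1⟩].  Its first component
   is the identity ([sym_deriv_homE]); its second one is the deriving transform. *)
Definition sym_deriv_hom (X : C) : alg_hom (FX X) (sqz P (free_module (FX X) X))
  := @ladj_lift _ _ _ F X (sqz P (free_module (FX X) X))
       (pair P (eta S X) (luniti X ;; (one (FX X) ⊗₁ idm X))).

Definition sym_deriv (X : C) : S X ~> S X ⊗ X := sym_deriv_hom X ;; pi2 P _ _.

Lemma sym_deriv_hom_eta (X : C) :
  eta S X ;; sym_deriv_hom X =
  pair P (eta S X) (luniti X ;; (one (FX X) ⊗₁ idm X)).
Proof. exact: (@ladj_liftE _ _ _ F X (sqz P (free_module (FX X) X))). Qed.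

Lemma sym_deriv_homE (X : C) :
  ahom (sym_deriv_hom X) = pair P (idm (S X)) (sym_deriv X).
Proof.
apply: pair_ext; rewrite ?pair_pi1 ?pair_pi2 //.
have e1 : ahom (sym_deriv_hom X) =
    pair P (sym_deriv_hom X ;; pi1 P _ _) (sym_deriv X).
  by apply: pair_ext; rewrite ?pair_pi1 ?pair_pi2.
apply: (@sym_hom_ext X (FX X)); last 1 first.
- by rewrite compA sym_deriv_hom_eta pair_pi1 compm1.
- have h := ahomP (sym_deriv_hom X); rewrite e1 in h.
  by case/pair_alg_hom: h.
- exact: (idm_alg_hom (FX X)).
Qed.

Lemma sym_deriv_derivation (X : C) :
  is_derivation (M := free_module (FX X) X) (sym_deriv X).
Proof.
by apply/(derivationP P); rewrite -sym_deriv_homE; apply: ahomP.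
Qed.

Lemma sym_deriv_eta (X : C) :
  eta S X ;; sym_deriv X = luniti X ;; (one (FX X) ⊗₁ idm X).
Proof. by rewrite /sym_deriv compA sym_deriv_hom_eta pair_pi2. Qed.

Lemma sym_derivation_ext (X : C) (B : comm_alg C) (M : module B)
    (f : S X ~> B) (D D' : S X ~> modcar M) :
  is_alg_hom (A := FX X) (B := sqz P M) (pair P f D) ->
  is_alg_hom (A := FX X) (B := sqz P M) (pair P f D') ->
  eta S X ;; D = eta S X ;; D' -> D = D'.
Proof.
move=> h h' e; rewrite -(pair_pi2 P f D) -(pair_pi2 P f D').
congr (_ ;; _); apply: (@sym_hom_ext X (sqz P M)) => //.
by rewrite !comp_pair e.
Qed.

Lemma derivation_comp (A B : comm_alg C) (N : module A) (M : module B)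
    (D : A ~> modcar N) (f : A ~> B) (g : modcar N ~> modcar M) :
  is_derivation D -> is_alg_hom f -> act N ;; g = (f ⊗₁ g) ;; act M ->
  is_alg_hom (A := A) (B := sqz P M) (pair P f (D ;; g)).
Proof.
move=> [hm h1] hf hg; apply/pair_alg_hom; split=> //; split; last first.
  by rewrite compA h1 comp0m.
rewrite compA hm addmC compDl -!compA hg !(compA (_ ⊗₁ D)) -!tensmM.
by rewrite comp1m.
Qed.

Lemma sym_nat (X Y : C) (f : X ~> Y) :
  is_alg_hom (A := FX X) (B := FX Y) (fmap S f).
Proof. exact: ahomP (fmap F f). Qed.

Lemma sym_mu_hom (X : C) :
  is_alg_hom (A := FX (S X)) (B := FX X) (mu S X).
Proof. exact: ahomP (acounit F (F X)). Qed.

Lemma pair_deriv_comp (X : C) (B : comm_alg C) (f : B ~> S X) :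
  is_alg_hom (B := FX X) f ->
  is_alg_hom (A := B) (B := sqz P (free_module (FX X) X))
    (pair P f (f ;; sym_deriv X)).
Proof.
move=> hf.
have -> : pair P f (f ;; sym_deriv X) = f ;; sym_deriv_hom X.
  by rewrite sym_deriv_homE comp_pair compm1.
exact: comp_alg_hom hf (ahomP (sym_deriv_hom X)).
Qed.

Lemma sym_deriv_nat (X Y : C) (f : X ~> Y) :
  fmap S f ;; sym_deriv Y = sym_deriv X ;; (fmap S f ⊗₁ f).
Proof.
have hf := sym_nat f.
apply: (sym_derivation_ext (M := free_module (FX Y) Y) (f := fmap S f)).
- exact: pair_deriv_comp.
- apply: (derivation_comp (sym_deriv_derivation X) hf).
  rewrite /= /free_act -!compA -tensmM [mul _ ;; _](hf.1) comp1m.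
  by rewrite compA associ_nat -compA -tensmM compm1.
- rewrite compA -eta_nat -compA sym_deriv_eta (compA (eta S X)) sym_deriv_eta.
  rewrite -compA -tensmM [one _ ;; _](hf.2) comp1m compA luniti_nat -compA.
  by rewrite -tensmM comp1m compm1.
Qed.

Lemma sym_deriv_mul (X : C) :
  mul (FX X) ;; sym_deriv X =
    (idm _ ⊗₁ sym_deriv X) ;; associ _ _ _ ;; (mul (FX X) ⊗₁ idm X)
    + (sym_deriv X ⊗₁ idm _) ;; swap _ _ ;; associ _ _ _
        ;; (mul (FX X) ⊗₁ idm X).
Proof.
have [-> _] := sym_deriv_derivation X.
by rewrite addmC /= (compA (_ ⊗₁ idm _) (swap _ _)) swap_nat -!compA.
Qed.

Lemma sym_deriv_mu (X : C) :
  mu S X ;; sym_deriv X =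
    sym_deriv (S X) ;; (mu S X ⊗₁ sym_deriv X) ;; associ _ _ _
      ;; (mul (FX X) ⊗₁ idm X).
Proof.
have hf := sym_mu_hom X.
apply: (sym_derivation_ext (M := free_module (FX X) X) (f := mu S X)).
- exact: pair_deriv_comp.
- apply: (derivation_comp (sym_deriv_derivation (S X)) hf).
  rewrite -/(free_act (FX X) X) -[free_act (FX X) X]/(act (free_module (FX X) X)).
  rewrite (act_act (M := free_module (FX X) X)) /= /free_act -!compA.
  congr (_ ;; _); rewrite -(hf.1 : mul (FX (S X)) ;; mu S X = _).
  rewrite [RHS]compA -(comp1m (sym_deriv X)) tensmM -compA comp1m.
  exact: compA.
- rewrite (reassoc _ (eta_mu S X)) comp1m (reassoc _ (sym_deriv_eta (S X))).
  exact/esym/(act_unit (M := free_module (FX X) X) (sym_deriv X) hf.2).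
Qed.

Definition sym_codifferential : codifferential C :=
  @Codifferential C S (fun X => astr (F X)) sym_nat sym_mu_hom sym_deriv
    sym_deriv_nat (fun X => (sym_deriv_derivation X).2) sym_deriv_mul
    sym_deriv_eta sym_deriv_mu.

Lemma comparison_malg (A : monad_alg sym_codifferential) :
  mact (comparison F (malg A : alg_cat C)) = mact A.
Proof.
apply: (@sym_hom_ext (mcar A) (malg A)).
- exact: ahomP (acounit F (malg A : alg_cat C)).
- by have [a b] := mact_hom A; split; [exact: a|exact: b].
- by rewrite [RHS](mact_unit A) -(mact_unit (comparison F (malg A : alg_cat C))).
Qed.

Lemma malg_comparison (B : comm_alg C) :
  let A := comparison F (B : alg_cat C) : monad_alg sym_codifferential in
  mul (malg A) = mul B /\ one (malg A) = one B.
Proof.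
move=> A; have [e e'] := ahomP (acounit F (B : alg_cat C)).
split; last exact: e'.
rewrite /= /malg_mul [mul _ ;; _]e compA -tensmM.
transitivity ((idm (acar B) ⊗₁ idm (acar B)) ;; mul B); last first.
  by rewrite tensm1 comp1m.
by congr ((_ ⊗₁ _) ;; _); exact: (mact_unit A).
Qed.

End SymmetricAlgebra.

(* Main.v *)
From mathcomp Require Import ssreflect ssrfun.
Require Import Defs.
Set Implicit Arguments.
Unset Strict Implicit.
Local Open Scope cat_scope.

(** Both notions compare [ν ;; D] with [d ;; (ν ⊗ D) ;; act], where [ν] is the
    structure map of [A]: being an S-derivation says exactly that they are equal.
    The latter is always a derivation along [ν] out of the free algebra, and the
    two agree on generators, so they coincide if and only if [ν ;; D] is a
    derivation along [ν]; as [ν] is an algebra map split by [η], this holds if and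
    only if [D] is a derivation. *)

(** The first components of the two sides of the homomorphism equation are both [mact A], so only
    the second components carry a condition. *)
Lemma S_derivationP (C : add_sym_monoidal) (P : finite_coproducts C)
    (S : codifferential C) (A : monad_alg S) (M : module (malg A))
    (D : mcar A ~> modcar M) :
  is_S_derivation P D <->
  mact A ;; D = deriv S (mcar A) ;; ((mact A ⊗₁ D) ;; act M).
Proof.
have e1 : fmap S (pair P (idm (mcar A)) D) ;; wact1 P M = mact A.
  by rewrite /wact1 compA -fmapM pair_pi1 fmap1 comp1m.
have e2 : fmap S (pair P (idm (mcar A)) D) ;; wact2 P M =
    deriv S (mcar A) ;; ((mact A ⊗₁ D) ;; act M).
  rewrite wact2E compA deriv_nat -compA (compA (_ ⊗₁ _)) -tensmM e1.
  by rewrite pair_pi2.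
rewrite /is_S_derivation /is_monad_hom /= /wact !comp_pair e1 e2 compm1.
split=> [e|->//].
by rewrite -(pair_pi2 P (mact A) (mact A ;; D)) -e pair_pi2.
Qed.

(** Linearity along [f] of the map that [h] induces on the free module: the compatibility required
    by [derivation_comp]. *)
Lemma free_module_extension (C : sym_monoidal) (A B : comm_alg C)
    (M : module B) (X : C) (f : A ~> B) (h : X ~> modcar M) :
  mul A ;; f = (f ⊗₁ f) ;; mul B ->
  act (free_module A X) ;; ((f ⊗₁ h) ;; act M) =
  (f ⊗₁ ((f ⊗₁ h) ;; act M)) ;; act M.
Proof.
move=> e; rewrite act_act -e /= /free_act -!compA; congr (_ ;; _).
by rewrite !compA -tensmM comp1m.
Qed.

Lemma precomp_derivation (C : add_sym_monoidal) (P : finite_coproducts C)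
    (A B : comm_alg C) (M : module B) (f : A ~> B) (D : B ~> modcar M) :
  is_alg_hom f -> is_derivation D ->
  is_alg_hom (A := A) (B := sqz P M) (pair P f (f ;; D)).
Proof.
move=> hf /(derivationP P) hD.
have -> : pair P f (f ;; D) = f ;; pair P (idm (acar B)) D.
  by rewrite comp_pair compm1.
exact: comp_alg_hom hf hD.
Qed.

Lemma derivation_descent (C : add_sym_monoidal) (P : finite_coproducts C)
    (A B : comm_alg C) (M : module B) (f : A ~> B) (h : acar B ~> acar A)
    (D : B ~> modcar M) :
  h ;; f = idm (acar B) ->
  is_alg_hom (A := A) (B := sqz P M) (pair P f (f ;; D)) -> is_derivation D.
Proof.
move=> e /pair_alg_hom [[fm f1] [Dm D1]]; split; last by rewrite -f1 -compA.
(* The section [h] rewrites the product of [B] through that of [A], where the Leibniz rule is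
   known. *)
have -> : mul B = (h ⊗₁ h) ;; (mul A ;; f).
  by rewrite fm compA -tensmM e tensm1 comp1m.
rewrite -!compA Dm compDr addmC (compA (h ⊗₁ h) (swap _ _)).
rewrite swap_nat -!compA !(compA (h ⊗₁ h)) -!tensmM !(compA h) e.
by rewrite comp1m.
Qed.

Theorem mainTheorem5 (C : add_sym_monoidal) (P : finite_coproducts C)
  (hcoeq : has_reflexive_coequalizers C)
  (htens : tensor_preserves_reflexive_coequalizers C)
  (F : left_adjoint (forget C))
  (A : monad_alg (sym_codifferential P F))
  (M : module (malg A))
  (D : mcar A ~> modcar M) :
  is_S_derivation P D <-> is_derivation (A := malg A) D.
Proof.
have nu_hom := mact_hom A.
have dD_hom : is_alg_hom (A := F (mcar A)) (B := sqz P M)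
    (pair P (mact A) (sym_deriv P F (mcar A) ;; ((mact A ⊗₁ D) ;; act M))).
  apply: (derivation_comp P (sym_deriv_derivation P F (mcar A)) nu_hom).
  exact: (free_module_extension D nu_hom.1).
split=> [/S_derivationP e|hD].
  rewrite -[_ ;; (_ ;; act M)]e in dD_hom.
  exact: (derivation_descent (B := malg A) (mact_unit A) dD_hom).
apply/S_derivationP.
apply: (sym_derivation_ext (precomp_derivation P nu_hom hD) dD_hom).
(* On generators both sides reduce to [D]: on the left [eta] splits [mact A], on the right [d] sends
   a generator [x] to [1 ⊗ x]. *)
rewrite (reassoc _ (mact_unit A)) comp1m (reassoc _ (sym_deriv_eta P F _)).
exact/esym/(act_unit D nu_hom.2).
Qed.
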